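(* Let $(y^\delta)_{\delta>0}$ be noisy data with $\|y^\delta-y\|\le\delta$, and for each $\delta>0$ let $\{x_n^\delta\}$ be generated by the RESESOP algorithm with two search directions described in the context, with stopping index $n_*(\delta)$ given by the discrepancy principle. Suppose that there is only one solution $x^+$ of $F(x)=y$ in $B_\rho(x_0)$, and that there is some $t>0$ such that $$\lim_{\delta\to0}|t_{n,i}^\delta|<t\quad\text{for all } n\in\mathbb{N} \text{ and all } i\in I_n,$$ where $I_0=\{0\}$ and $I_n=\{n-1,n\}$ for $n\ge1$. Then the algorithm together with the discrepancy principle yields a regularized solution $x_{n_*(\delta)}^\delta$ of $F(x)=y$, i.e. $$x_{n_*(\delta)}^\delta\to x^+\quad\text{for }\delta\to0.$$
   Context: Setting. $X,Y$ are real Hilbert spaces, $F:\mathcal{D}(F)\subset X\to Y$ is a (nonlinear) operator, $y\in Y$ is exact data. $B_r(a)$ denotes the closed ball of radius $r$ about $a$. $F$ is continuous and Fr\'echet differentiable in a ball $B_\rho(x_0)\subset\mathcal{D}(F)$, $\rho>0$, with continuous Fr\'echet derivative $F'$; $F'(x)^*:Y\to X$ denotes the Hilbert space adjoint of $F'(x)$. There is a solution $x^+\in B_{\rho/2}(x_0)$ of $F(x)=y$. The tangential cone condition holds: there is a constant $0\le c_{\mathrm{tc}}<1$ with $\|F(x)-F(\tilde x)-F'(x)(x-\tilde x)\|\le c_{\mathrm{tc}}\|F(x)-F(\tilde x)\|$ for all $x,\tilde x\in B_\rho(x_0)$. There is $c_F>0$ with $\|F'(x)\|<c_F$ for all $x\in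 B_\rho(x_0)$. $F$ is weakly sequentially closed: if $x_n\rightharpoonup x$ and $F(x_n)\to y'$, then $x\in\mathcal{D}(F)$ and $F(x)=y'$. For $u\in X$, $\alpha\in\mathbb{R}$, $\xi\ge 0$: $H(u,\alpha):=\{x\in X:\langle u,x\rangle=\alpha\}$, $H_>(u,\alpha):=\{x\in X:\langle u,x\rangle>\alpha\}$, $H_<(u,\alpha):=\{x\in X:\langle u,x\rangle<\alpha\}$, and the stripe is $H(u,\alpha,\xi):=\{x\in X: |\langle u,x\rangle-\alpha|\le\xi\}$. $P_C$ denotes the metric projection onto a nonempty closed convex set $C\subset X$. RESESOP algorithm with two search directions. Fix a constant $\tau>\frac{1+c_{\mathrm{tc}}}{1-c_{\mathrm{tc}}}$ (the same for all $\delta$). Start with $x_0^\delta:=x_0$. Put $R_n^\delta:=F(x_n^\delta)-y^\delta$, $u_n^\delta:=F'(x_n^\delta)^*R_n^\delta$, $\alpha_n^\delta:=\langle u_n^\delta,x_n^\delta\rangle-\|R_n^\delta\|^2$, $\xi_n^\delta:=\|R_n^\delta\|\bigl(\delta+c_{\mathrm{tc}}(\|R_n^\delta\|+\delta)\bigr)$, $H_n^\delta:=H(u_n^\delta,\alpha_n^\delta,\xi_n^\delta)$ and $H_{-1}^\delta:=X$. If $\|R_n^\delta\|\le\tau\delta$ (discrepancy principle), stop. Otherwise compute $x_{n+1}^\delta$ as follows: (i) Compute $\tilde x_{n+1}^\delta:=P_{H(u_n^\delta,\alpha_n^\delta+\xi_n^\delta)}(x_n^\delta)=x_n^\delta-\frac{\langle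 u_n^\delta,x_n^\delta\rangle-(\alpha_n^\delta+\xi_n^\delta)}{\|u_n^\delta\|^2}u_n^\delta$. If $\tilde x_{n+1}^\delta\in H_{n-1}^\delta$, set $x_{n+1}^\delta:=\tilde x_{n+1}^\delta$. (ii) Otherwise, set $x_{n+1}^\delta:=P_{H(u_n^\delta,\alpha_n^\delta+\xi_n^\delta)\cap H(u_{n-1}^\delta,\alpha_{n-1}^\delta\pm\xi_{n-1}^\delta)}(\tilde x_{n+1}^\delta)$, with the sign $+$ if $\tilde x_{n+1}^\delta\in H_>(u_{n-1}^\delta,\alpha_{n-1}^\delta+\xi_{n-1}^\delta)$ and the sign $-$ if $\tilde x_{n+1}^\delta\in H_<(u_{n-1}^\delta,\alpha_{n-1}^\delta-\xi_{n-1}^\delta)$. The stopping index is $n_*(\delta):=\min\{n\in\mathbb{N}:\|R_n^\delta\|\le\tau\delta\}$, which is finite, and one sets $x_n^\delta:=x_{n_*(\delta)}^\delta$ for $n>n_*(\delta)$. The parameters $t_{n,i}^\delta$ are the real coefficients in the representation $x_{n+1}^\delta=x_n^\delta-\sum_{i\in I_n}t_{n,i}^\delta u_i^\delta$ of the step produced by the algorithm (so $t_{n,n-1}^\delta=0$ if step (ii) is not carried out, and $t_{n,i}^\delta=0$ for $n\ge n_*(\delta)$). *)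

(* Defs.v *)
From HB Require Import structures.
From mathcomp Require Import all_boot all_order all_algebra.
From mathcomp Require Import all_classical all_reals all_analysis.
Set Implicit Arguments.
Unset Strict Implicit.
Unset Printing Implicit Defensive.
Import Order.TTheory GRing.Theory Num.Theory.
Import numFieldNormedType.Exports.
Local Open Scope classical_set_scope.
Local Open Scope ring_scope.

HB.mixin Record hasInner (R : realType) X of CompleteNormedModule R X := {
  inner : X -> X -> R ;
  innerC : forall x y : X, inner x y = inner y x ;
  innerDl : forall x y z : X, inner (x + y) z = inner x z + inner y z ;
  innerZl : forall (a : R) (x y : X), inner (a *: x) y = a * inner x y ;
  inner_norm : forall x : X, inner x x = `|x| ^+ 2
}.

#[short(type="hilbertType")]
HB.structure Definition Hilbert (R : realType) :=
  {X of CompleteNormedModule R X & hasInner R X}.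

Section Operators.
Context {R : realType} {X Y : hilbertType R}.

(* Only meaningful for bounded A. *)
Definition opnorm (A : X -> Y) : R :=
  sup [set `|A h| | h in [set h : X | `|h| <= 1]].

(* For bounded linear A, the Riesz theorem provides exactly one such B. *)
Definition adjoint (A : X -> Y) : Y -> X :=
  get [set B : Y -> X | forall x y, inner (A x) y = inner x (B y)].

(* F is a partial map with domain D, so the limit is taken within D: the values
   of F outside D are irrelevant, also when x is a boundary point of D. *)
Definition frechet_derivative (D : set X) (F : X -> Y) (x : X)
    (A : {linear X -> Y}) : Prop :=
  continuous A /\
  (fun z => F z - F x - A (z - x)) =o_ (within D (nbhs x)) (fun z => z - x).

Definition weak_cvg (s : nat -> X) (x : X) : Prop :=
  forall w : X, inner w (s n) @[n --> \oo] --> inner w x.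

Definition weakly_seq_closed (D : set X) (F : X -> Y) : Prop :=
  forall (s : nat -> X) (x : X) (y : Y), (forall n, D (s n)) ->
    weak_cvg s x -> F (s n) @[n --> \oo] --> y -> D x /\ F x = y.

Definition tangential_cone (B : set X) (F : X -> Y)
    (dF : X -> {linear X -> Y}) (c : R) : Prop :=
  forall x x', B x -> B x' ->
    `|F x - F x' - dF x (x - x')| <= c * `|F x - F x'|.

End Operators.

Section Projections.
Context {R : realType} {X : hilbertType R}.

Definition hyperplane (u : X) (a : R) : set X := [set x | inner u x = a].
Definition halfspace_gt (u : X) (a : R) : set X := [set x | inner u x > a].
Definition halfspace_lt (u : X) (a : R) : set X := [set x | inner u x < a].
Definition stripe (u : X) (a xi : R) : set X :=
  [set x | `|inner u x - a| <= xi].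

Definition metric_proj (C : set X) (x : X) : X :=
  get [set p | C p /\ forall q, C q -> `|x - p| <= `|x - q|].

End Projections.

Section Resesop.
Context {R : realType} {X Y : hilbertType R}.
Variables (F : X -> Y) (dF : X -> {linear X -> Y}) (ctc tau : R).
Variables (delta : R) (yd : Y).

(* R_n, u_n, alpha_n, xi_n and H_n depend on n only through the iterate x_n. *)
Definition residual (x : X) : Y := F x - yd.
Definition search_dir (x : X) : X := adjoint (dF x) (residual x).
Definition offset (x : X) : R :=
  inner (search_dir x) x - `|residual x| ^+ 2.
Definition width (x : X) : R :=
  `|residual x| * (delta + ctc * (`|residual x| + delta)).
Definition stripe_at (x : X) : set X :=
  stripe (search_dir x) (offset x) (width x).
Definition upper_hyperplane (x : X) : set X :=
  hyperplane (search_dir x) (offset x + width x).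
Definition lower_hyperplane (x : X) : set X :=
  hyperplane (search_dir x) (offset x - width x).

Definition discrepancy (x : X) : Prop := `|residual x| <= tau * delta.

Definition tilde_step (x : X) : X := metric_proj (upper_hyperplane x) x.

Definition prev_stripe (x : nat -> X) (n : nat) : set X :=
  if n is m.+1 then stripe_at (x m) else setT.

(* The first clause encodes x_n = x_{n_*} for n > n_*. *)
Definition resesop (x0 : X) (x : nat -> X) : Prop :=
  x 0%N = x0 /\
  forall n, let xt := tilde_step (x n) in
    [/\ discrepancy (x n) -> x n.+1 = x n,
        ~ discrepancy (x n) -> prev_stripe x n xt -> x n.+1 = xt &
        forall m, n = m.+1 -> ~ discrepancy (x n) ->
          (halfspace_gt (search_dir (x m)) (offset (x m) + width (x m)) xt ->
           x n.+1 =
             metric_proj (upper_hyperplane (x n) `&` upper_hyperplane (x m)) xt)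
          /\
          (halfspace_lt (search_dir (x m)) (offset (x m) - width (x m)) xt ->
           x n.+1 =
             metric_proj (upper_hyperplane (x n) `&` lower_hyperplane (x m)) xt)].

(* The default value 0 of get would only be used if the discrepancy principle
   were never satisfied. *)
Definition stopping_index (x : nat -> X) : nat :=
  get [set n : nat | discrepancy (x n) /\
                     forall m, (m < n)%N -> ~ discrepancy (x m)].

Definition indices (n : nat) : seq nat :=
  if n is m.+1 then [:: m; m.+1] else [:: 0%N].

Definition step_coefficients (x : nat -> X) (t : nat -> nat -> R) : Prop :=
  forall n,
    [/\ ~ discrepancy (x n) ->
          x n.+1 = x n - \sum_(i <- indices n) t n i *: search_dir (x i),
        forall m, n = m.+1 -> ~ discrepancy (x n) ->
          stripe_at (x m) (tilde_step (x n)) -> t n m = 0 &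
        discrepancy (x n) -> forall i, i \in indices n -> t n i = 0].

End Resesop.

(* Main.v *)
Require Import Defs.
From mathcomp Require Import all_boot all_order all_algebra.
From mathcomp Require Import all_classical all_reals all_analysis.
From mathcomp Require Import ring lra zify.
Set Implicit Arguments.
Unset Strict Implicit.
Unset Printing Implicit Defensive.
Import Order.TTheory GRing.Theory Num.Theory.
Import numFieldNormedType.Exports.
Local Open Scope classical_set_scope.
Local Open Scope ring_scope.

(* Each step projects onto hyperplanes that separate the iterate from xplus, so
   |x_n^delta - xplus| is nonincreasing in n, with a decrease of the square of at
   least C |R_n^delta|^2 as long as the discrepancy principle fails, and C does
   not depend on delta. If the claim fails, some eps and an ultrafilter G finer
   than 0^'+ satisfy |x_n^delta - xplus| >= eps along G for all n (by
   monotonicity in n up to the stopping index). Along G the coefficients t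
   converge, hence, by induction on n, so does x_n^delta, to a sequence x_n that
   obeys the same recursion for exact data with uniformly bounded coefficients.
   The argument of Hanke, Neubauer and Scherzer shows that (x_n) is Cauchy; its
   limit solves F x = y and hence is xplus, which contradicts the bound eps. *)

(** * Hilbert spaces: Riesz representation and adjoints *)

Section InnerProduct.
Context {R : realType} {X : hilbertType R}.
Implicit Types (x y z : X) (a : R).

Lemma innerDr x y z : inner x (y + z) = inner x y + inner x z.
Proof. by rewrite innerC innerDl ![inner _ x]innerC. Qed.

Lemma innerZr a x y : inner x (a *: y) = a * inner x y.
Proof. by rewrite innerC innerZl innerC. Qed.

Lemma innerNl x y : inner (- x) y = - inner x y.
Proof. by rewrite -scaleN1r innerZl mulN1r. Qed.

Lemma innerNr x y : inner x (- y) = - inner x y.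
Proof. by rewrite innerC innerNl innerC. Qed.

Lemma innerBl x y z : inner (x - y) z = inner x z - inner y z.
Proof. by rewrite innerDl innerNl. Qed.

Lemma innerBr x y z : inner x (y - z) = inner x y - inner x z.
Proof. by rewrite innerDr innerNr. Qed.

Lemma inner0l x : inner 0 x = 0.
Proof. by rewrite -(scale0r x) innerZl mul0r. Qed.

Lemma sqr_normD x y : `|x + y| ^+ 2 = `|x| ^+ 2 + 2 * inner x y + `|y| ^+ 2.
Proof. by rewrite -!inner_norm innerDl !innerDr (innerC y x); ring. Qed.

Lemma sqr_normB x y : `|x - y| ^+ 2 = `|x| ^+ 2 - 2 * inner x y + `|y| ^+ 2.
Proof. by rewrite sqr_normD innerNr normrN mulrN. Qed.

Lemma cauchy_schwarz x y : `|inner x y| <= `|x| * `|y|.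
Proof.
have [->|y0] := eqVneq y 0; first by rewrite innerC inner0l normr0 mulr_ge0.
have ny : 0 < `|y| by rewrite normr_gt0.
rewrite -(@ler_pXn2r _ 2) ?nnegrE ?mulr_ge0// real_normK ?num_real//.
(* This vector is [|y| ^+ 2] times the component of [x] orthogonal to [y]; the scaling avoids a
   division. *)
have := sqr_ge0 `| (`|y| ^+ 2) *: x - inner x y *: y|.
rewrite exprMn sqr_normB !normrZ innerZl innerZr !exprMn !(real_normK (num_real _)) => h.
have : 0 <= `|y| ^+ 2 * (`|x| ^+ 2 * `|y| ^+ 2 - inner x y ^+ 2) by nra.
by rewrite pmulr_rge0 ?exprn_gt0// subr_ge0 ?exprMn.
Qed.

Lemma inner_le x y : inner x y <= `|x| * `|y|.
Proof. exact: le_trans (ler_norm _) (cauchy_schwarz x y). Qed.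

Lemma normX_gt0 x : x != 0 -> 0 < `|x| ^+ 2.
Proof. by move=> x0; rewrite exprn_gt0 ?normr_gt0. Qed.

End InnerProduct.

(** Comparing the tail with the single term [s N] spares estimates with two free indices. *)
Lemma cauchy_seq_cvg (R : realType) (X : completeNormedModType R) (s : nat -> X) :
  (forall e, 0 < e -> exists N, forall n, (N <= n)%N -> `|s N - s n| < e) ->
  cvg (s n @[n --> \oo]).
Proof.
move=> cs; apply/cauchy_cvgP/cauchy_exP => e /cs[N sN].
exists (s N), N => //= n Nn.
by rewrite -ball_normE /=; exact: sN.
Qed.

Section Riesz.
Context {R : realType} {X : hilbertType R} (f : X -> R) (M : R).
Hypotheses (fD : forall x y, f (x + y) = f x + f y)
  (fZ : forall a x, f (a *: x) = a * f x)
  (fM : forall x, `|f x| <= M * `|x|).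

Let energy x : R := `|x| ^+ 2 - 2 * f x.

Let energy_ge x : - M ^+ 2 <= energy x.
Proof.
have := le_trans (ler_norm _) (fM x); have := sqr_ge0 (`|x| - M).
by rewrite /energy; nra.
Qed.

(* Parallelogram identity: minimizing sequences of the energy are Cauchy. *)
Let energy_mid x y :
  energy x + energy y = 2 * energy (2^-1 *: (x + y)) + `|x - y| ^+ 2 / 2.
Proof.
rewrite /energy fZ fD normrZ exprMn sqr_normD sqr_normB ger0_norm ?invr_ge0//.
by field.
Qed.

Let fB x y : f (x - y) = f x - f y.
Proof. by rewrite fD -scaleN1r fZ mulN1r. Qed.

(** The representer is the minimizer of [energy]: a minimizing sequence converges, and the first
    variation at its limit vanishes. *)
Lemma riesz : exists v, forall x, f x = inner x v.
Proof.
pose E := range energy; pose m := inf E.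
have infE : has_inf E.
  by split; [exists (energy 0), 0|exists (- M ^+ 2) => _ [x _ <-]].
have mE x : m <= energy x by apply: ge_inf; [exact: infE.2|exists x].
have /choice[s sE] (n : nat) : exists x, energy x < m + n.+1%:R^-1.
  have [|_ [x _ <-] ?] := inf_adherent (_ : 0 < n.+1%:R^-1 :> R) infE => //.
  by exists x.
have dist_s i j : `|s i - s j| ^+ 2 <= 2 * (i.+1%:R^-1 + j.+1%:R^-1).
  have := energy_mid (s i) (s j); have := mE (2^-1 *: (s i + s j)).
  by have := sE i; have := sE j; move: i.+1%:R^-1 j.+1%:R^-1 => *; lra.
have s_cvg : cvg (s n @[n --> \oo]).
  apply: cauchy_seq_cvg => e e0.
  (* For [n >= N], [dist_s] bounds the squared distance by [4 / N.+1], which this [N] makes smaller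
     than [e ^+ 2]. *)
  pose N := Num.truncn (4 / e ^+ 2); exists N => n Nn.
  rewrite -(@ltr_pXn2r _ 2) ?nnegrE ?(ltW e0)//.
  apply: (le_lt_trans (dist_s _ _)).
  have nN : n.+1%:R^-1 <= N.+1%:R^-1 :> R.
    by rewrite lef_pV2 ?posrE// ler_nat.
  have : 4 / e ^+ 2 < N.+1%:R := truncnS_gt _.
  rewrite ltr_pdivrMr ?exprn_gt0// -ltr_pdivrMl// => {}Nn.
  move: N.+1%:R^-1 n.+1%:R^-1 nN Nn => a b ab.
  by rewrite mulrC; lra.
have /cvg_ex[v sv] := s_cvg.
have mv : energy v <= m.
  have Ev : energy (s n) @[n --> \oo] --> energy v.
    apply: cvgB; first by apply: cvgM; apply: cvg_norm.
    apply: cvgMl_tmp; apply/cvgrPdist_lt => e e0.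
    have M0 : 0 < `|M| + 1 by rewrite ltr_wpDl.
    near=> n; rewrite -fB; apply: (le_lt_trans (fM _)).
    apply: (@le_lt_trans _ _ ((`|M| + 1) * `|v - s n|)).
      by rewrite ler_wpM2r// (le_trans (ler_norm M))// lerDl.
    rewrite -ltr_pdivlMl//; near: n; move/cvgrPdist_lt: sv; apply.
    by rewrite mulr_gt0 ?invr_gt0.
  have mn : m + n.+1%:R^-1 @[n --> \oo] --> m + 0.
    by apply: cvgD; [exact: cvg_cst|exact: cvg_harmonic].
  rewrite -[leRHS]addr0; apply: (ler_cvg_to Ev mn).
  by apply: nearW => n; exact: ltW.
exists v => h; apply/eqP; rewrite eq_le; apply/andP.
pose c := inner h v - f h.
have quad r : 0 <= r ^+ 2 * `|h| ^+ 2 + 2 * r * c.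
  have := le_trans mv (mE (v + r *: h)).
  rewrite /energy fD fZ sqr_normD normrZ exprMn real_normK ?num_real//.
  by rewrite innerZr (innerC v); rewrite /c; lra.
suff : c = 0 by rewrite /c => c0; split; lra.
apply/eqP; rewrite -sqrf_eq0 eq_le sqr_ge0 andbT.
have h1 : 0 < `|h| ^+ 2 + 1 by rewrite ltr_wpDl ?sqr_ge0.
(* Up to the summand 1, which covers [h = 0], this is the minimizer of the quadratic in [quad]; its
   value there is a negative multiple of [c ^+ 2]. *)
have := quad (- (c / (`|h| ^+ 2 + 1))).
rewrite sqrrN expr_div_n mulrN mulNr.
set H := `|h| ^+ 2 in h1 *.
have -> : c ^+ 2 / (H + 1) ^+ 2 * H - 2 * (c / (H + 1)) * c
    = - (c ^+ 2 * ((H + 2) / (H + 1) ^+ 2)) by field; lra.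
by rewrite oppr_ge0 pmulr_lle0// divr_gt0 ?exprn_gt0//; lra.
Unshelve. all: by end_near. Qed.
End Riesz.

Section Adjoint.
Context {R : realType} {X Y : hilbertType R}.
Implicit Types A B : {linear X -> Y}.

(** Riesz for each [y], followed by a choice over [y], shows that the set in [adjoint] is inhabited,
    so [get] returns one of its members. *)
Lemma adjointP A M : (forall h, `|A h| <= M * `|h|) ->
  forall x y, inner (A x) y = inner x (adjoint A y).
Proof.
move=> AM; suff /getPex : exists B : Y -> X,
  forall x y, inner (A x) y = inner x (B y) by [].
have /choice[B BP] (y : Y) : exists v, forall x, inner (A x) y = inner x v.
  apply: (@riesz _ _ _ (M * `|y|)) => [x x'|a x|x].
  - by rewrite linearD innerDl.
  - by rewrite linearZ innerZl.
  - by rewrite (le_trans (cauchy_schwarz _ _))// mulrAC ler_wpM2r.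
by exists B => x y.
Qed.

Lemma adjoint_le A M : 0 <= M -> (forall h, `|A h| <= M * `|h|) ->
  forall y, `|adjoint A y| <= M * `|y|.
Proof.
move=> M0 AM y; set u := adjoint A y.
have [->|u0] := eqVneq u 0; first by rewrite normr0 mulr_ge0.
rewrite -(@ler_pM2r _ `|u|) ?normr_gt0// -expr2 -inner_norm -(adjointP AM).
by rewrite (le_trans (inner_le _ _))// mulrAC ler_wpM2r.
Qed.

(** The bound [M] serves to make the [sup] in [opnorm] a true supremum; the estimate itself comes
    from normalizing [h]. *)
Lemma opnorm_le A M : (forall h, `|A h| <= M * `|h|) ->
  forall h, `|A h| <= opnorm A * `|h|.
Proof.
move=> AM h.
have [->|h0] := eqVneq h 0; first by rewrite linear0 !normr0 mulr0.
have nh : 0 < `|h| by rewrite normr_gt0.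
rewrite -ler_pdivrMr// mulrC.
have -> : `|h|^-1 * `|A h| = `|A (`|h|^-1 *: h)|.
  by rewrite linearZ normrZ ger0_norm// invr_ge0.
apply: ub_le_sup; last first.
  exists (`|h|^-1 *: h) => //=.
  by rewrite normrZ ger0_norm ?invr_ge0// mulVf ?gt_eqF.
exists `|M| => _ [k /= k1 <-]; apply: le_trans (AM k) _.
have := ler_norm M; have := normr_ge0 k; have := normr_ge0 M.
by nra.
Qed.

Lemma continuous_linear_bound A : continuous A ->
  exists2 M, 0 <= M & forall h, `|A h| <= M * `|h|.
Proof.
move=> /linear_bounded_continuous /linear_boundedP /pinfty_ex_gt0[M M0 AM].
by exists M => //; exact: ltW.
Qed.

Lemma continuous_opnorm_le A : continuous A ->
  forall h, `|A h| <= opnorm A * `|h|.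
Proof. by move=> /continuous_linear_bound[M _ AM]; exact: opnorm_le AM. Qed.

Lemma opnormB_le A B : continuous A -> continuous B ->
  forall h, `|A h - B h| <= opnorm (A \- B) * `|h|.
Proof.
move=> /continuous_linear_bound[M _ AM] /continuous_linear_bound[N _ BN].
apply: (@opnorm_le (A \- B : {linear X -> Y}) (M + N)) => h /=.
by rewrite (le_trans (ler_normB _ _))// mulrDl lerD.
Qed.

End Adjoint.

(** * Projections and descent of the iterates *)

Section MetricProjection.
Context {R : realType} {X : hilbertType R}.
Implicit Types (u v x z p : X) (a b : R) (C : set X).

(** By Pythagoras [p] is the unique nearest point of [C], so [get] can only return [p].
    Orthogonality with equality suits affine sets. *)
Lemma metric_projE C x p : C p -> (forall q, C q -> inner (x - p) (p - q) = 0) ->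
  metric_proj C x = p.
Proof.
move=> Cp xp; have pyth q : C q -> `|x - q| ^+ 2 = `|x - p| ^+ 2 + `|p - q| ^+ 2.
  move=> Cq; have -> : x - q = x - p + (p - q) by rewrite addrA subrK.
  by rewrite sqr_normD xp// mulr0 addr0.
have /getPex[] : exists p, C p /\ forall q, C q -> `|x - p| <= `|x - q|.
  exists p; split => // q /pyth xq.
  by rewrite -(@ler_pXn2r _ 2) ?nnegrE// xq lerDl sqr_ge0.
rewrite -/(metric_proj C x); set g := metric_proj C x => Cg /(_ _ Cp).
rewrite -(@ler_pXn2r _ 2) ?nnegrE// (pyth _ Cg) gerDl => pg.
by apply/esym/eqP; rewrite -subr_eq0 -normr_eq0 -sqrf_eq0 eq_le pg sqr_ge0.
Qed.

Lemma metric_proj_hyperplane u a x : u != 0 ->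
  metric_proj (hyperplane u a) x = x - ((inner u x - a) / `|u| ^+ 2) *: u.
Proof.
move=> u0; have nu := normX_gt0 u0; apply: metric_projE => [|q /= uq].
  by rewrite /hyperplane/= innerBr innerZr inner_norm; field; rewrite normr_eq0.
rewrite opprB addrC subrK innerZl !innerBr innerZr inner_norm uq.
by field; rewrite normr_eq0.
Qed.

Lemma proj_halfspace_descent u a x z : u != 0 -> inner u z <= a <= inner u x ->
  `|metric_proj (hyperplane u a) x - z| ^+ 2 <=
    `|x - z| ^+ 2 - (inner u x - a) ^+ 2 / `|u| ^+ 2.
Proof.
move=> u0 /andP[uz ux]; have nu := normX_gt0 u0.
rewrite metric_proj_hyperplane//; set r := (_ / _).
have -> : x - r *: u - z = x - z - r *: u by rewrite addrAC.
rewrite sqr_normB innerZr normrZ exprMn {}/r.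
rewrite real_normK ?num_real// (innerC _ u) innerBr.
rewrite addrAC -addrA lerD2l -subr_ge0.
(* The slack is twice the step length times the amount by which [z] lies beyond the hyperplane. *)
rewrite [leRHS](_ : _ = 2 * ((inner u x - a) / `|u| ^+ 2) * (a - inner u z)).
  by rewrite !mulr_ge0 ?invr_ge0 ?subr_ge0// ltW.
by field; rewrite normr_eq0.
Qed.

(* The projection point is [xt - w], where [w] is a multiple of the component
   [v'] of [v] orthogonal to [u]; [v' <> 0], for otherwise [z] and [xt] would
   contradict each other. *)
Lemma proj_two_halfspaces u v a b x z (xt := metric_proj (hyperplane u a) x)
    (p := metric_proj (hyperplane u a `&` hyperplane v b) xt) : u != 0 ->
  inner u z <= a < inner u x -> inner v z <= b -> inner v x <= b < inner v xt ->
  inner u p = a /\ `|p - z| ^+ 2 <= `|xt - z| ^+ 2.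
Proof.
move=> u0 /andP[uz ux] vz /andP[vx vxt]; have nu := normX_gt0 u0.
have xtE : xt = x - ((inner u x - a) / `|u| ^+ 2) *: u.
  exact: metric_proj_hyperplane.
have uxt : inner u xt = a.
  by rewrite xtE innerBr innerZr inner_norm; field; rewrite normr_eq0.
(* Moving from [x] to [xt] along [- u] has increased [inner v]. Hence [k > 0], and [v'] is a
   nonnegative combination of [u] and [v], so the half-space bounds on [z] carry over to [v']. *)
have uv : inner u v < 0.
  have : (inner u x - a) / `|u| ^+ 2 * inner u v < 0.
    by move: vxt; rewrite xtE innerBr innerZr (innerC v u); lra.
  by rewrite pmulr_rlt0// divr_gt0// subr_gt0.
pose k := - inner u v / `|u| ^+ 2.
have k0 : 0 < k by rewrite divr_gt0// oppr_gt0.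
pose v' := v + k *: u.
have uv' : inner u v' = 0.
  by rewrite innerDr innerZr inner_norm /k; field; rewrite normr_eq0.
have v'0 : v' != 0.
  apply/eqP => v'0; have : inner v' xt <= inner v' z by rewrite v'0 !inner0l.
  by rewrite !innerDl !innerZl uxt; nra.
have nv' := normX_gt0 v'0.
have vv' : inner v v' = `|v'| ^+ 2.
  by rewrite -(inner_norm v') {2}/v' innerDl innerZl uv' mulr0 addr0.
pose s := (inner v xt - b) / `|v'| ^+ 2.
have s0 : 0 < s by rewrite divr_gt0// subr_gt0.
have sv : s * inner v v' = inner v xt - b.
  by rewrite vv' /s; field; rewrite normr_eq0.
have pE : p = xt - s *: v'.
  apply: metric_projE => [|q [uq vq]].
    split; rewrite /hyperplane/= innerBr innerZr ?uv' ?uxt ?mulr0 ?subr0//.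
    by rewrite sv opprB addrC subrK.
  rewrite opprB addrC subrK innerZl !innerBr innerZr inner_norm -vv' sv.
  by rewrite /v' !innerDl !innerZl uxt uq vq; ring.
have up : inner u p = a by rewrite pE innerBr innerZr uv' uxt mulr0 subr0.
have vp : inner v p = b by rewrite pE innerBr innerZr sv opprB addrC subrK.
split=> //; have -> : xt - z = p - z + s *: v' by rewrite pE addrAC subrK.
have ip : 0 <= inner (p - z) v'.
  by rewrite innerC innerBr subr_ge0 !innerDl !innerZl up vp lerD// ler_pM2l.
rewrite [leRHS]sqr_normD innerZr.
by have := sqr_ge0 `|s *: v'|; have := mulr_ge0 (ltW s0) ip; lra.
Qed.

End MetricProjection.

(** * Monotone decrease of the error for noisy data *)

Section Descent.
Context {R : realType} {X Y : hilbertType R}.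
Variables (F : X -> Y) (dF : X -> {linear X -> Y}) (B : set X) (ctc tau cF : R).
Variables (delta : R) (y yd : Y) (z : X).
Hypotheses (ctc_ge0 : 0 <= ctc) (ctc_lt1 : ctc < 1) (cF_gt0 : 0 < cF)
  (tau_large : (1 + ctc) / (1 - ctc) < tau) (delta_gt0 : 0 < delta)
  (tcc : tangential_cone B F dF ctc)
  (dF_le : forall x, B x -> forall h, `|dF x h| <= cF * `|h|)
  (noise : `|yd - y| <= delta) (Bz : B z) (Fz : F z = y).

Local Notation residual := (residual F yd).
Local Notation search_dir := (search_dir F dF yd).
Local Notation offset := (offset F dF yd).
Local Notation width := (width F ctc delta yd).
Local Notation stripe_at := (stripe_at F dF ctc delta yd).
Local Notation upper_hyperplane := (upper_hyperplane F dF ctc delta yd).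
Local Notation lower_hyperplane := (lower_hyperplane F dF ctc delta yd).
Local Notation discrepancy := (discrepancy F tau delta yd).
Local Notation tilde_step := (tilde_step F dF ctc delta yd).

(** By [gap_ge] and [search_dir_le], the squared distance from an iterate to its upper hyperplane is
    at least this factor times the squared residual. It does not involve [delta]. *)
Definition descent_rate : R := ((1 - ctc - (1 + ctc) / tau) / cF) ^+ 2.

Lemma tau_gt0 : 0 < tau.
Proof.
apply: le_lt_trans tau_large.
by apply: divr_ge0; [exact: addr_ge0|rewrite subr_ge0 ltW].
Qed.

Lemma descent_gap_gt0 : 0 < 1 - ctc - (1 + ctc) / tau.
Proof.
by rewrite subr_gt0 ltr_pdivrMr ?tau_gt0// mulrC -ltr_pdivrMr// subr_gt0.
Qed.

Lemma descent_rate_gt0 : 0 < descent_rate.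
Proof. by rewrite exprn_gt0// divr_gt0// descent_gap_gt0. Qed.

Lemma width_ge0 x : 0 <= width x.
Proof.
have d0 := ltW delta_gt0.
by rewrite /width mulr_ge0// addr_ge0// mulr_ge0// addr_ge0.
Qed.

Lemma residual_gt0 x : ~ discrepancy x -> tau * delta < `|residual x|.
Proof. by move=> /negP; rewrite -ltNge. Qed.

(** The deviation of [inner u z] from the offset is the inner product of the residual with the
    linearization error plus the data error. Cauchy-Schwarz and the cone condition, with
    [|F x - y| <= |r| + delta], yield exactly [width]. *)
Lemma solution_in_stripe x : B x -> stripe_at x z.
Proof.
move=> Bx; rewrite /stripe_at/= /stripe /offset /width /=.
set r := residual x; set u := search_dir x.
have uE w : inner u w = inner r (dF x w).
  by rewrite innerC -(adjointP (dF_le Bx)) innerC.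
have -> : inner u z - (inner u x - `|r| ^+ 2) =
    inner r (F x - F z - dF x (x - z) + (y - yd)).
  rewrite !uE (linearB (dF x)) Fz -inner_norm {4}/r /residual /Defs.residual.
  by rewrite !(innerDr, innerNr); ring.
apply: le_trans (cauchy_schwarz _ _) _; rewrite ler_wpM2l// addrC.
apply: le_trans (ler_normD _ _) (lerD _ _); first by rewrite distrC.
apply: le_trans (tcc Bx Bz) _; rewrite ler_wpM2l// Fz.
have -> : F x - y = r + (yd - y) by rewrite /r /Defs.residual addrA subrK.
by apply: le_trans (ler_normD _ _) _; rewrite lerD2l.
Qed.

Lemma search_dir_le x : B x -> `|search_dir x| <= cF * `|residual x|.
Proof. by move=> Bx; apply: adjoint_le (ltW cF_gt0) (dF_le Bx) _. Qed.

Lemma gap_ge x : ~ discrepancy x ->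
  (1 - ctc - (1 + ctc) / tau) * `|residual x| ^+ 2 <=
    inner (search_dir x) x - (offset x + width x).
Proof.
move=> /residual_gt0 tr; rewrite /offset /width.
set r := `|residual x| in tr *.
have r0 : 0 < r by apply: lt_trans tr; rewrite mulr_gt0// tau_gt0.
have dr : delta <= r / tau by rewrite ler_pdivlMr ?tau_gt0// mulrC ltW.
(* The gap equals [r * ((1 - ctc) * r - (1 + ctc) * delta)]; the slack comes from replacing [delta]
   by its upper bound [r / tau]. *)
rewrite -subr_ge0 [leRHS](_ : _ = r * ((1 + ctc) * (r / tau - delta))).
  apply: mulr_ge0; first exact: ltW.
  by apply: mulr_ge0; [exact: addr_ge0|rewrite subr_ge0].
by rewrite mulrBl; ring.
Qed.

Lemma gap_gt0 x : ~ discrepancy x -> offset x + width x < inner (search_dir x) x.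
Proof.
move=> nd; rewrite -subr_gt0; apply: lt_le_trans (gap_ge nd).
rewrite mulr_gt0 ?descent_gap_gt0// exprn_gt0//.
by apply: lt_trans (residual_gt0 nd); rewrite mulr_gt0// tau_gt0.
Qed.

(** The iterate lies strictly above the upper hyperplane and the solution does not; for a zero
    direction both would have the value 0. *)
Lemma search_dir_neq0 x : B x -> ~ discrepancy x -> search_dir x != 0.
Proof.
move=> Bx nd; apply/eqP => u0; have := gap_gt0 nd.
have := solution_in_stripe Bx; rewrite /stripe_at/= /stripe/= ler_norml.
by rewrite u0 !inner0l; lra.
Qed.

Lemma solution_lt_upper x : B x -> inner (search_dir x) z <= offset x + width x.
Proof.
move=> Bx; have := solution_in_stripe Bx; rewrite /stripe_at/= /stripe/=.
by rewrite ler_norml; lra.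
Qed.

Lemma tilde_step_descent x : B x -> ~ discrepancy x ->
  `|tilde_step x - z| ^+ 2 <= `|x - z| ^+ 2 - descent_rate * `|residual x| ^+ 2.
Proof.
move=> Bx nd; have u0 := search_dir_neq0 Bx nd.
apply: le_trans (proj_halfspace_descent u0 _) _.
  by rewrite solution_lt_upper// ltW// gap_gt0.
rewrite lerD2l lerN2 ler_pdivlMr ?normX_gt0//.
have g0 := ltW descent_gap_gt0.
apply: (@le_trans _ _
    (((1 - ctc - (1 + ctc) / tau) * `|residual x| ^+ 2) ^+ 2)).
  have -> : (1 - ctc - (1 + ctc) / tau) * `|residual x| ^+ 2 =
      (1 - ctc - (1 + ctc) / tau) / cF * `|residual x| * (cF * `|residual x|).
    by field; rewrite gt_eqF// gt_eqF// tau_gt0.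
  rewrite /descent_rate -exprMn [leRHS]exprMn; apply: ler_wpM2l; first exact: sqr_ge0.
  by rewrite ler_pXn2r ?nnegrE ?mulr_ge0 ?(ltW cF_gt0)// search_dir_le.
rewrite ler_pXn2r ?nnegrE ?gap_ge ?mulr_ge0 ?sqr_ge0//.
by rewrite subr_ge0 ltW// gap_gt0.
Qed.

Lemma tilde_step_upper x : B x -> ~ discrepancy x ->
  upper_hyperplane x (tilde_step x).
Proof.
move=> Bx nd; have u0 := search_dir_neq0 Bx nd; have nu := normX_gt0 u0.
rewrite /tilde_step metric_proj_hyperplane// /upper_hyperplane /hyperplane/=.
by rewrite innerBr innerZr inner_norm; field; rewrite normr_eq0.
Qed.

(** Membership of the new iterate in its upper hyperplane is carried along because the next step
    needs it: it places that iterate on the admissible side of the previous stripe's boundary, as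
    [proj_two_halfspaces] requires. *)
Lemma resesop_step_descent x0 x n : resesop F dF ctc tau delta yd x0 x ->
    B (x n) -> ~ discrepancy (x n) ->
    (forall m, n = m.+1 -> B (x m) /\ upper_hyperplane (x m) (x n)) ->
  upper_hyperplane (x n) (x n.+1) /\
  `|x n.+1 - z| ^+ 2 <= `|x n - z| ^+ 2 - descent_rate * `|residual (x n)| ^+ 2.
Proof.
move=> [_ /(_ n)] /=; case: n => [|m] [_ step1 step2] Bn nd prev.
  by rewrite step1//; split; [exact: tilde_step_upper|exact: tilde_step_descent].
have [Bm xm] := prev _ erefl.
have [instripe|outstripe] := pselect (stripe_at (x m) (tilde_step (x m.+1))).
  by rewrite step1//; split; [exact: tilde_step_upper|exact: tilde_step_descent].
have [gt_step lt_step] := step2 _ erefl nd.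
have u0 := search_dir_neq0 Bn nd.
have un : inner (search_dir (x m.+1)) z <= offset (x m.+1) + width (x m.+1) <
  inner (search_dir (x m.+1)) (x m.+1) by rewrite solution_lt_upper ?gap_gt0.
have := solution_in_stripe Bm; rewrite /stripe_at/= /stripe/= ler_norml => /andP[zm1 zm2].
have [gt|le] := ltP (offset (x m) + width (x m))
    (inner (search_dir (x m)) (tilde_step (x m.+1))).
  rewrite gt_step//.
  have [||pu pd] := proj_two_halfspaces u0 un (v := search_dir (x m))
    (b := offset (x m) + width (x m)).
  - by lra.
  - by rewrite xm lexx.
  split; first exact: pu.
  exact: le_trans pd (tilde_step_descent Bn nd).
have lt : inner (search_dir (x m)) (tilde_step (x m.+1)) <
    offset (x m) - width (x m).
  rewrite ltNge; apply/negP => ge; apply: outstripe.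
  by rewrite /stripe_at /stripe /= ler_norml; lra.
rewrite lt_step//.
(* Reversing the normal turns the lower boundary into an upper one, so that the same projection
   lemma applies. *)
have -> : lower_hyperplane (x m) =
    hyperplane (- search_dir (x m)) (- (offset (x m) - width (x m))).
  apply/seteqP; split=> q; rewrite /lower_hyperplane /hyperplane /= innerNl.
    by move=> ->.
  by move=> /oppr_inj.
have [||pu pd] := proj_two_halfspaces u0 un (v := - search_dir (x m))
    (b := - (offset (x m) - width (x m))).
- by rewrite innerNl; lra.
- rewrite !innerNl xm; apply/andP; split; last by rewrite ltrN2.
  rewrite lerN2 lerD2l; apply: (@le_trans _ _ 0); last exact: width_ge0.
  by rewrite oppr_le0 width_ge0.
split; first exact: pu.
exact: le_trans pd (tilde_step_descent Bn nd).
Qed.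

Variables (x0 : X) (x : nat -> X).
Hypotheses (x0_ball : forall w, `|w - z| <= `|x0 - z| -> B w)
  (x_resesop : resesop F dF ctc tau delta yd x0 x).

Lemma discrepancy_fixed n : discrepancy (x n) -> x n.+1 = x n.
Proof. by move: x_resesop => [_ /(_ n)[]]. Qed.

(** Both claims need each other: the distance bound keeps the iterates in [B], where the step lemma
    applies, and the step gives the next bound. *)
Let resesop_invariant n : [/\ `|x n - z| <= `|x0 - z| &
  ~ discrepancy (x n) -> upper_hyperplane (x n) (x n.+1) /\
  `|x n.+1 - z| ^+ 2 <= `|x n - z| ^+ 2 - descent_rate * `|residual (x n)| ^+ 2].
Proof.
elim: n => [|n [IHle IHd]].
  have le0 : `|x 0 - z| <= `|x0 - z| by rewrite x_resesop.1.
  split=> // nd; apply: (resesop_step_descent x_resesop) => //; exact: x0_ball.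
have leS : `|x n.+1 - z| <= `|x0 - z|.
  apply: le_trans IHle; have [/discrepancy_fixed -> //|nd] := pselect (discrepancy (x n)).
  rewrite -(@ler_pXn2r _ 2) ?nnegrE//; apply: le_trans (IHd nd).2 _.
  by rewrite gerBl mulr_ge0 ?sqr_ge0// ltW// descent_rate_gt0.
split=> // nd; apply: (resesop_step_descent x_resesop) => //.
  exact: x0_ball.
move=> m [<-]; split; first exact: x0_ball.
(* Had the discrepancy principle held at [x n], then [x n.+1 = x n] would satisfy it too, against
   [nd]. *)
by apply: (IHd _).1 => /[dup] /discrepancy_fixed <-.
Qed.

Lemma iterate_le_start n : `|x n - z| <= `|x0 - z|.
Proof. by have [] := resesop_invariant n. Qed.

Lemma iterate_descent n : ~ discrepancy (x n) ->
  `|x n.+1 - z| ^+ 2 <= `|x n - z| ^+ 2 - descent_rate * `|residual (x n)| ^+ 2.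
Proof. by have [_ /[apply] -[]] := resesop_invariant n. Qed.

Lemma iterate_le_succ n : `|x n.+1 - z| <= `|x n - z|.
Proof.
have [/discrepancy_fixed -> //|/iterate_descent d] := pselect (discrepancy (x n)).
rewrite -(@ler_pXn2r _ 2) ?nnegrE//; apply: le_trans d _.
by rewrite gerBl mulr_ge0 ?sqr_ge0// ltW// descent_rate_gt0.
Qed.

Lemma iterate_nonincreasing m n : (m <= n)%N -> `|x n - z| <= `|x m - z|.
Proof.
move=> /subnK <-; elim: (n - m)%N => // k; apply: le_trans.
by rewrite addSn iterate_le_succ.
Qed.

(** Otherwise every step would lower the squared error by at least the fixed amount [e], making it
    negative eventually. *)
Lemma discrepancy_reached : exists n, discrepancy (x n).
Proof.
apply: contrapT => /forallNP nd.
pose e := descent_rate * (tau * delta) ^+ 2.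
have e0 : 0 < e.
  by rewrite mulr_gt0 ?descent_rate_gt0// exprn_gt0// mulr_gt0// tau_gt0.
have le n : `|x n - z| ^+ 2 <= `|x0 - z| ^+ 2 - n%:R * e.
  elim: n => [|n IH]; first by rewrite mul0r subr0 x_resesop.1.
  apply: le_trans (iterate_descent (nd n)) _.
  have : e <= descent_rate * `|residual (x n)| ^+ 2.
    rewrite ler_pM2l ?descent_rate_gt0// ler_pXn2r ?nnegrE//.
      by rewrite ltW// residual_gt0.
    by rewrite ltW// mulr_gt0// tau_gt0.
  by rewrite -natr1; lra.
have := truncnS_gt (`|x0 - z| ^+ 2 / e); rewrite ltr_pdivrMr// ltNge => /negP; apply.
by rewrite -subr_ge0; apply: le_trans (le _); exact: sqr_ge0.
Qed.

(** Before the stopping index this is monotonicity; after it the iterates are frozen. A lower bound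
    on the final error thus holds at every fixed [n], although the stopping index varies with
    [delta]. *)
Lemma stopping_index_le n :
  `|x (stopping_index F tau delta yd x) - z| <= `|x n - z|.
Proof.
have /getPex : exists n, discrepancy (x n) /\
    forall m, (m < n)%N -> ~ discrepancy (x m).
  have ex : exists n, `[< discrepancy (x n) >].
    by have [k kd] := discrepancy_reached; exists k; exact/asboolP.
  case: (ex_minnP ex) => k /asboolP kd kmin; exists k; split=> // m mk /asboolP md.
  by have := kmin _ md; rewrite leqNgt mk.
rewrite -/(stopping_index F tau delta yd x); set k := stopping_index _ _ _ _ _.
move=> [kd _]; have [/iterate_nonincreasing//|/ltnW /subnK <-] := leqP n k.
have -> // : forall j, x (j + k)%N = x k.
by elim=> // j IH; rewrite addSn -IH; apply: discrepancy_fixed; rewrite IH.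
Qed.

End Descent.

(** * Iterations with exact data *)

Section TangentialCone.
Context {R : realType} {X Y : hilbertType R}.
Variables (F : X -> Y) (dF : X -> {linear X -> Y}) (B : set X) (ctc cF : R).
Hypotheses (ctc_lt1 : ctc < 1) (tcc : tangential_cone B F dF ctc)
  (dF_le : forall x, B x -> forall h, `|dF x h| <= cF * `|h|).

Lemma tangential_cone_le x x' : B x -> B x' ->
  `|dF x (x - x')| <= (1 + ctc) * `|F x - F x'|.
Proof.
move=> Bx Bx'; have := tcc Bx Bx'; rewrite distrC => t.
have -> : dF x (x - x') = dF x (x - x') - (F x - F x') + (F x - F x').
  by rewrite subrK.
by apply: le_trans (ler_normD _ _) _; lra.
Qed.

(** Since [ctc < 1], the linearization error can be absorbed into the left-hand side. *)
Lemma tangential_cone_lipschitz x x' : B x -> B x' ->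
  `|F x - F x'| <= cF / (1 - ctc) * `|x - x'|.
Proof.
move=> Bx Bx'; rewrite mulrAC ler_pdivlMr ?subr_gt0//.
apply: le_trans (dF_le Bx _); have := tcc Bx Bx' => t.
have := lerB_dist (F x - F x') (dF x (x - x')).
by lra.
Qed.

Lemma cvg_tangential_cone T (G : set_system T) {GF : Filter G} (s : T -> X) w :
  B w -> (\forall t \near G, B (s t)) -> s t @[t --> G] --> w ->
  F (s t) @[t --> G] --> F w.
Proof.
move=> Bw Bs sw; apply/cvgrPdist_lt => e e0; pose L := `|cF / (1 - ctc)| + 1.
have L0 : 0 < L by rewrite ltr_wpDl.
near=> t; apply: (le_lt_trans (tangential_cone_lipschitz Bw _)).
  by near: t.
apply: (@le_lt_trans _ _ (L * `|w - s t|)).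
  by rewrite ler_wpM2r// (le_trans (ler_norm _))// lerDl.
rewrite -ltr_pdivlMl//; near: t; move/cvgrPdist_lt: sw; apply.
by rewrite mulr_gt0 ?invr_gt0.
Unshelve. all: by end_near. Qed.

End TangentialCone.

Lemma min_on_segment (R : realType) (r : nat -> R) p d :
  exists l, [/\ (p <= l)%N, (l <= p + d)%N &
    forall j, (p <= j <= p + d)%N -> r l <= r j].
Proof.
elim: d => [|d [l [pl ld lmin]]].
  by exists p; split; rewrite ?leq_addr// => j; rewrite addn0 -eqn_leq => /eqP ->.
have [le|/ltW gt] := leP (r l) (r (p + d.+1)%N).
  exists l; split=> // [|j /andP[pj]]; first by rewrite addnS leqW.
  by rewrite addnS leq_eqVlt => /predU1P[->|jd]; [rewrite -addnS|apply: lmin; rewrite pj].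
exists (p + d.+1)%N; split; rewrite ?leq_addr// => j /andP[pj].
rewrite addnS leq_eqVlt => /predU1P[->//|jd].
by rewrite -addnS (le_trans gt)// lmin// pj.
Qed.

(** * Cauchy property and limit of the exact-data sequence *)

Section LimitSequence.
Context {R : realType} {X Y : hilbertType R}.
Variables (F : X -> Y) (dF : X -> {linear X -> Y}) (B : set X) (ctc cF : R).
Variables (y : Y) (z : X) (x : nat -> X) (s : nat -> nat -> R) (M C : R).
Hypotheses (ctc_ge0 : 0 <= ctc) (ctc_lt1 : ctc < 1)
  (tcc : tangential_cone B F dF ctc)
  (dF_le : forall x, B x -> forall h, `|dF x h| <= cF * `|h|)
  (Bz : B z) (Fz : F z = y) (Bx : forall n, B (x n)) (M_ge0 : 0 <= M) (C_gt0 : 0 < C)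
  (sM : forall n i, i \in indices n -> `|s n i| <= M)
  (step : forall n, x n.+1 =
    x n - \sum_(i <- indices n) s n i *: search_dir F dF y (x i))
  (descent : forall n,
    `|x n.+1 - z| ^+ 2 <= `|x n - z| ^+ 2 - C * `|F (x n) - y| ^+ 2).

Let a n : R := `|x n - z| ^+ 2.
Let r n : R := `|F (x n) - y|.
(** In [step_inner], [M] bounds the coefficients, 4 absorbs the products of residuals, and [1 / C]
    converts squared residuals into decrements of [a]. *)
Let K : R := 4 * M * (1 + ctc) / C.

Let K_ge0 : 0 <= K.
Proof. by rewrite /K !mulr_ge0 ?addr_ge0// invr_ge0 ltW. Qed.

Let a_succ n : C * r n ^+ 2 <= a n - a n.+1.
Proof. by have := descent n; rewrite /a /r; lra. Qed.

Let a_nonincreasing m n : (m <= n)%N -> a n <= a m.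
Proof.
move=> /subnK <-; elim: (n - m)%N => // k; apply: le_trans; rewrite addSn.
by rewrite -subr_ge0; apply: le_trans (a_succ _); rewrite mulr_ge0 ?sqr_ge0// ltW.
Qed.

(** After passing to the adjoint, [x l - z] is split at [x i], so that [dF (x i)] acts only on
    differences based at [x i], where the cone condition applies. *)
Let search_dir_inner i l : `|inner (search_dir F dF y (x i)) (x l - z)| <=
  (1 + ctc) * (r i * r l + 2 * r i ^+ 2).
Proof.
rewrite innerC -(adjointP (dF_le (Bx i))) innerC.
apply: le_trans (cauchy_schwarz _ _) _.
have dl := tangential_cone_le tcc (Bx i) (Bx l).
have dz := tangential_cone_le tcc (Bx i) Bz.
have -> : x l - z = x i - z - (x i - x l).
  by rewrite opprB [RHS]addrC addrA subrK.
rewrite (linearB (dF (x i))).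
have rl : `|F (x i) - F (x l)| <= r i + r l.
  have -> : F (x i) - F (x l) = (F (x i) - y) - (F (x l) - y).
    by rewrite opprB addrA subrK.
  exact: ler_normB.
rewrite Fz -/(r i) in dz.
have c1 : 0 <= 1 + ctc by rewrite addr_ge0.
have dn : `|dF (x i) (x i - z) - dF (x i) (x i - x l)| <= (1 + ctc) * (2 * r i + r l).
  apply: le_trans (ler_normB _ _) _.
  have := ler_wpM2l c1 rl; lra.
have -> : (1 + ctc) * (r i * r l + 2 * r i ^+ 2) =
  r i * ((1 + ctc) * (2 * r i + r l)) by ring.
by rewrite ler_wpM2l.
Qed.

(** Only [r k.+1] is compared with [r l]: the older direction contributes
    [r k * r l <= r k * r k.+1], so [k] may precede the segment on which [r l] is minimal. *)
Let step_inner k l : r l <= r k.+1 ->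
  `|inner (x k.+1 - x k.+2) (x l - z)| <= K * (a k - a k.+2).
Proof.
move=> lk; have -> : x k.+1 - x k.+2 = s k.+1 k *: search_dir F dF y (x k)
    + s k.+1 k.+1 *: search_dir F dF y (x k.+1).
  by rewrite (step k.+1) opprB addrCA subrr addr0 !big_cons big_nil addr0.
rewrite innerDl !innerZl; apply: le_trans (ler_normD _ _) _; rewrite !normrM.
have s1 : `|s k.+1 k| <= M by apply: sM; rewrite inE eqxx.
have s2 : `|s k.+1 k.+1| <= M by apply: sM; rewrite !inE eqxx orbT.
have e1 := ler_pM (normr_ge0 _) (normr_ge0 _) s1 (search_dir_inner k l).
have e2 := ler_pM (normr_ge0 _) (normr_ge0 _) s2 (search_dir_inner k.+1 l).
apply: le_trans (lerD e1 e2) _.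
apply: (@le_trans _ _ (K * (C * r k ^+ 2 + C * r k.+1 ^+ 2))); last first.
  by rewrite ler_wpM2l//; have := a_succ k; have := a_succ k.+1; lra.
have -> : K * (C * r k ^+ 2 + C * r k.+1 ^+ 2) =
    M * (1 + ctc) * (4 * (r k ^+ 2 + r k.+1 ^+ 2)) by rewrite /K; field; rewrite gt_eqF.
rewrite !(mulrA M) -mulrDr; apply: ler_wpM2l.
  by rewrite mulr_ge0// addr_ge0.
have rl0 := ler_wpM2l (normr_ge0 (F (x k) - y)) lk.
have rl1 := ler_wpM2l (normr_ge0 (F (x k.+1) - y)) lk.
have := sqr_ge0 (r k - r k.+1); rewrite -/(r k) -/(r k.+1) in rl0 rl1 *.
by rewrite sqrrB; have := sqr_ge0 (r k); have := sqr_ge0 (r k.+1); lra.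
Qed.

(** Each step costs a decrement over two indices; these overlap, so two boundary terms survive at
    either end. *)
Let telescope p d l :
    (forall j, (p.+1 <= j <= p.+1 + d)%N -> r l <= r j) ->
  `|inner (x p.+1 - x (p.+1 + d)%N) (x l - z)| <=
    K * (a p + a p.+1 - a (p + d)%N - a (p.+1 + d)%N).
Proof.
elim: d => [|d IH] lmin.
  rewrite !addn0 subrr inner0l normr0 [leRHS](_ : _ = 0)//; ring.
have -> : x p.+1 - x (p.+1 + d.+1)%N =
    x p.+1 - x (p.+1 + d)%N + (x (p.+1 + d)%N - x (p.+1 + d.+1)%N).
  by rewrite addrA subrK.
rewrite innerDl; apply: le_trans (ler_normD _ _) _.
have h1 : `|inner (x p.+1 - x (p.+1 + d)%N) (x l - z)| <=
    K * (a p + a p.+1 - a (p + d)%N - a (p.+1 + d)%N).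
  by apply: IH => j /andP[pj jd]; apply: lmin; rewrite pj addnS leqW.
have h2 : `|inner (x (p + d).+1 - x (p + d).+2) (x l - z)| <=
    K * (a (p + d)%N - a (p + d).+2).
  by apply: step_inner; apply: lmin; rewrite ltnS leq_addr/= addSn ltnS leq_add2l leqW.
move: h1 h2; rewrite !addSn !addnS => h1 h2; apply: le_trans (lerD h1 h2) _.
by rewrite -mulrDr ler_wpM2l//; lra.
Qed.

Let dist_split p q : `|x p - x q| ^+ 2 =
  a p - a q + 2 * inner (x q - x p) (x q - z).
Proof.
rewrite /a; have -> : x p - z = x p - x q + (x q - z) by rewrite addrA subrK.
by rewrite [in RHS]sqr_normD -(opprB (x p)) innerNl; ring.
Qed.

(* [x l] with minimal residual is the pivot: the inner products of [telescope]
   involve residuals at indices in the segment only, each at least [r l]. *)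
Let dist_le p d : `|x p.+1 - x (p.+1 + d)%N| ^+ 2 <=
  4 * (1 + 4 * K) * (a p - a (p.+1 + d)%N).
Proof.
have [l [pl ld lmin]] := min_on_segment r p.+1 d.
pose d1 := (l - p.+1)%N; pose d2 := (d - d1)%N; pose q := (p.+1 + d)%N.
have lE : l = (p.+1 + d1)%N by rewrite /d1 subnKC.
have dE : d = (d1 + d2)%N by rewrite /d2 subnKC// leq_subLR.
have qE : q = ((p + d1).+1 + d2)%N by rewrite /q dE addnA addSn.
have h1 : inner (x l - x p.+1) (x l - z) <= K * (2 * a p - 2 * a q).
  apply: le_trans (ler_norm _) _; rewrite -opprB innerNl normrN.
  have := @telescope p d1 l; rewrite -lE => h; apply: le_trans (h _) _.
    by move=> j /andP[pj jl]; apply: lmin; rewrite pj (leq_trans jl).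
  rewrite ler_wpM2l//; have := a_nonincreasing (leqnSn p).
  have := a_nonincreasing ld; rewrite -/q.
  have : a q <= a (p + d1)%N by apply: a_nonincreasing; rewrite /q dE; lia.
  by lra.
have h2 : inner (x l - x q) (x l - z) <= K * (2 * a p - 2 * a q).
  apply: le_trans (ler_norm _) _.
  have := @telescope (p + d1)%N d2 l; rewrite -qE -addSn -lE => h.
  apply: le_trans (h _) _.
    by move=> j /andP[lj jq]; apply: lmin; rewrite (leq_trans pl lj).
  rewrite ler_wpM2l//.
  have : a (p + d1)%N <= a p by apply: a_nonincreasing; rewrite leq_addr.
  have : a l <= a p by apply: a_nonincreasing; rewrite ltnW.
  have : a q <= a (p + d1 + d2)%N by apply: a_nonincreasing; rewrite /q dE; lia.
  by lra.
have e1 := dist_split p.+1 l; have e2 := dist_split q l.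
have ap := a_nonincreasing (leqnSn p).
have aql : a q <= a l by apply: a_nonincreasing.
have -> : x p.+1 - x (p.+1 + d)%N = (x p.+1 - x l) - (x q - x l).
  by rewrite opprB addrA subrK.
move: (x p.+1 - x l) (x q - x l) e1 e2 => v w e1 e2.
(* This gives [|v - w|^2 <= 2 |v|^2 + 2 |w|^2]. *)
have := sqr_ge0 `|v + w|; rewrite sqr_normB sqr_normD -/q e1 e2.
have : a q <= a p by apply: a_nonincreasing; rewrite /q; lia.
by lra.
Qed.

(** By [dist_le] it suffices to start where the nonincreasing sequence [a] is within [e ^+ 2 / D] of
    its infimum. *)
Lemma limit_sequence_cvg : cvg (x n @[n --> \oo]).
Proof.
pose D := 4 * (1 + 4 * K).
have D0 : 0 < D by rewrite mulr_gt0// ltr_pwDl// mulr_ge0.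
have infa : has_inf (range a).
  by split; [exists (a 0), 0|exists 0 => _ [n _ <-]; exact: sqr_ge0].
apply: cauchy_seq_cvg => e e0.
have [|_ [p _ <-] ap] := inf_adherent (_ : 0 < e ^+ 2 / D) infa.
  by rewrite divr_gt0 ?exprn_gt0.
exists p.+1 => n /subnKC <-; set d := (n - p.+1)%N.
rewrite -(@ltr_pXn2r _ 2) ?nnegrE ?(ltW e0)//.
apply: (le_lt_trans (dist_le p d)); rewrite -/D mulrC -ltr_pdivlMr//.
have : inf (range a) <= a (p.+1 + d)%N.
  by apply: ge_inf; [exact: infa.2|exists (p.+1 + d)%N].
by rewrite ltrBlDr; move: ap => /lt_le_trans ap ?; apply: ap; rewrite addrC lerD2l.
Qed.

(** The squared residuals are bounded by multiples of the differences of the convergent sequence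
    [a], hence vanish in the limit. *)
Lemma limit_sequence_solution : closed B ->
  exists w, [/\ x n @[n --> \oo] --> w, B w & F w = y].
Proof.
move=> clB; have /cvg_ex[w xw] := limit_sequence_cvg.
have Bw : B w by apply: (closed_cvg B clB _ w xw); exact: nearW.
exists w; split=> //; apply/eqP.
rewrite -subr_eq0 -normr_eq0 -sqrf_eq0 eq_le sqr_ge0 andbT -(pmulr_rle0 _ C_gt0).
have Fw : F (x n) @[n --> \oo] --> F w.
  by apply: (cvg_tangential_cone ctc_lt1 tcc dF_le) => //; exact: nearW.
have r_cvg : C * r n ^+ 2 @[n --> \oo] --> C * `|F w - y| ^+ 2.
  apply: cvgMl_tmp; rewrite expr2; under eq_fun do rewrite expr2.
  by apply: cvgM; apply: cvg_norm; apply: cvgB => //; exact: cvg_cst.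
have a_cvg : a n @[n --> \oo] --> `|w - z| ^+ 2.
  rewrite expr2; under eq_fun do rewrite /a expr2.
  by apply: cvgM; apply: cvg_norm; apply: cvgB => //; exact: cvg_cst.
have da : a n - a n.+1 @[n --> \oo] --> (0 : R).
  by rewrite -(subrr (`|w - z| ^+ 2)); apply: cvgB => //; rewrite cvg_shiftS.
by apply: (ler_cvg_to r_cvg da); apply: nearW => n; exact: a_succ.
Qed.
End LimitSequence.

(** * Passing to the limit along an ultrafilter *)

Section FilterLemmas.
Context {R : realType}.

Lemma cvg_bigsum T (G : set_system T) {GF : Filter G} (V : normedModType R)
    (r : seq nat) (f : nat -> T -> V) (l : nat -> V) :
  (forall i, i \in r -> f i t @[t --> G] --> l i) ->
  \sum_(i <- r) f i t @[t --> G] --> \sum_(i <- r) l i.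
Proof.
elim: r => [|i r IH] fl.
  by under eq_fun do rewrite big_nil; rewrite big_nil; exact: cvg_cst.
under eq_fun do rewrite big_cons; rewrite big_cons; apply: cvgD.
  by apply: fl; rewrite mem_head.
by apply: IH => j jr; apply: fl; rewrite in_cons jr orbT.
Qed.

(** An ultrafilter decides the sign of [f], so convergence of the absolute value fixes the limit of
    [f] itself. *)
Lemma ultrafilter_cvg_norm T (G : set_system T) {GU : UltraFilter G}
    (f : T -> R) (l : R) : `|f t| @[t --> G] --> l ->
  exists2 l', f t @[t --> G] --> l' & `|l'| <= l.
Proof.
move=> fl; have l0 : 0 <= l by apply: (cvgr_to_ge fl); exact: nearW.
have [f0|f0] := in_ultra_setVsetC [set t | 0 <= f t] GU.
  exists l; last by rewrite ger0_norm.
  apply: cvg_trans fl; apply: near_eq_cvg; apply: filterS f0 => t /= ft.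
  by rewrite ger0_norm.
exists (- l); last by rewrite normrN ger0_norm.
apply: cvg_trans (cvgN fl); apply: near_eq_cvg; apply: filterS f0 => t /= /negP.
by rewrite -ltNge => ft; rewrite opprfctE ltr0_norm// opprK.
Qed.

(** The restriction of [Fl] to the set where [f] stays away from [l] is proper, and any ultrafilter
    extending it will do. *)
Lemma not_cvg_ultrafilter (V : normedModType R) T (Fl : set_system T)
    {FF : ProperFilter Fl} (f : T -> V) (l : V) : ~ (f t @[t --> Fl] --> l) ->
  exists2 e, 0 < e & exists G : set_system T,
    [/\ UltraFilter G, Fl `<=` G & \forall t \near G, e <= `|f t - l|].
Proof.
move=> nfl; have [e /not_implyP[e0 ne]] :
    exists e, ~ (0 < e -> \forall t \near Fl, `|l - f t| < e).
  by apply/existsNP => h; apply: nfl; apply/cvgrPdist_lt.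
exists e => //; pose S := [set t | e <= `|f t - l|].
have FS : ProperFilter (within S Fl).
  apply: Build_ProperFilter => h; apply: ne.
  have {}h : \forall t \near Fl, ~ S t := h.
  apply: filterS h => t /= h.
  by rewrite ltNge distrC; apply/negP.
have [G [GU FG]] := ultraFilterLemma FS.
exists G; split=> // [A FA|]; first by apply: FG; apply: filterS FA => t At _.
by apply: FG; exact: (withinT S).
Qed.

End FilterLemmas.

(** * Continuity of the search direction in the iterate and the data *)

Section SearchDirection.
Context {R : realType} {X Y : hilbertType R}.

Lemma opnorm_ge0 (A : X -> Y) : 0 <= opnorm A.
Proof.
(* Where no supremum exists, [sup] takes the default value 0. *)
have [sE|/sup_out E0] := pselect (has_sup [set `|A h| | h in [set h : X | `|h| <= 1]]).
  apply: le_trans (normr_ge0 (A 0)) _; apply: (ub_le_sup sE.2).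
  by exists 0 => //=; rewrite normr0.
by rewrite /opnorm E0.
Qed.

(** The difference [e] is tested against itself, and its squared norm splits into
    [inner (A' e) (v' - v)] and [inner (A' e - A e) v]. *)
Lemma adjointB_le (A A' : {linear X -> Y}) (M : R) (v v' : Y) :
    0 <= M -> continuous A -> continuous A' -> (forall h, `|A' h| <= M * `|h|) ->
  `|adjoint A' v' - adjoint A v| <=
    M * `|v' - v| + opnorm (A' \- A) * `|v|.
Proof.
move=> M0 Ac A'c A'M; have [N _ AN] := continuous_linear_bound Ac.
set e := _ - _; have [->|e0] := eqVneq e 0.
  by rewrite normr0 addr_ge0// mulr_ge0// opnorm_ge0.
rewrite -(@ler_pM2r _ `|e|) ?normr_gt0// -expr2 -inner_norm {2}/e innerBr.
rewrite -(adjointP A'M) -(adjointP AN).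
have -> : inner (A' e) v' - inner (A e) v =
    inner (A' e) (v' - v) + inner (A' e - A e) v.
  by rewrite innerBr innerBl; ring.
rewrite mulrDl; apply: lerD; apply: le_trans (inner_le _ _) _.
  by rewrite mulrAC ler_wpM2r.
by rewrite mulrAC ler_wpM2r// opnormB_le.
Qed.

Variables (F : X -> Y) (dF : X -> {linear X -> Y}) (B : set X) (ctc cF : R).
Hypotheses (ctc_lt1 : ctc < 1) (tcc : tangential_cone B F dF ctc)
  (cF_ge0 : 0 <= cF)
  (dF_le : forall x, B x -> forall h, `|dF x h| <= cF * `|h|)
  (dFx_continuous : forall x, B x -> continuous (dF x))
  (dF_continuous : forall x, B x ->
     opnorm (dF z \- dF x) @[z --> within B (nbhs x)] --> 0).

Lemma cvg_search_dir T (G : set_system T) {GF : Filter G} (s : T -> X)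
    (yd : T -> Y) w y : B w -> (\forall t \near G, B (s t)) ->
  s t @[t --> G] --> w -> yd t @[t --> G] --> y ->
  search_dir F dF (yd t) (s t) @[t --> G] --> search_dir F dF y w.
Proof.
move=> Bw Bs sw ydy.
have Rw : residual F (yd t) (s t) @[t --> G] --> residual F y w.
  by apply: cvgB => //; exact: (cvg_tangential_cone ctc_lt1 tcc dF_le).
have dw : opnorm (dF (s t) \- dF w) @[t --> G] --> (0 : R).
  apply: cvg_comp (dF_continuous Bw) => A wA.
  have {}wA : \forall t \near G, B (s t) -> A (s t) := sw _ wA.
  by apply: filterS2 Bs wA => t Bt; apply.
apply/cvgrPdist_lt => e e0.
have : cF * `|residual F (yd t) (s t) - residual F y w|
    + opnorm (dF (s t) \- dF w) * `|residual F y w| @[t --> G] --> (0 : R).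
  have -> : (0 : R) = cF * `|residual F y w - residual F y w| + 0 * `|residual F y w|.
    by rewrite subrr normr0 mulr0 mul0r addr0.
  apply: cvgD; last by apply: cvgM => //; exact: cvg_cst.
  apply: cvgM; first exact: cvg_cst.
  by apply: cvg_norm; apply: cvgB => //; exact: cvg_cst.
move=> /cvgr_lt /(_ _ e0) bd; near=> t; rewrite distrC.
apply: le_lt_trans (adjointB_le _ _ _ _ _ _) _; last by near: t; exact: bd.
- by [].
- exact: dFx_continuous.
- by apply: dFx_continuous; near: t.
- by move=> h; apply: dF_le; near: t.
Unshelve. all: by end_near. Qed.

End SearchDirection.

Theorem theorem4p9 (R : realType) (X Y : hilbertType R)
  (D : set X) (F : X -> Y) (dF : X -> {linear X -> Y}) (y : Y)
  (x0 xplus : X) (rho ctc cF tau : R)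
  (rho_gt0 : 0 < rho)
  (ball_sub_D : closed_ball x0 rho `<=` D)
  (F_continuous : {within closed_ball x0 rho, continuous F})
  (F_differentiable : forall x, closed_ball x0 rho x ->
     frechet_derivative D F x (dF x))
  (dF_continuous : forall x, closed_ball x0 rho x ->
     opnorm (dF z \- dF x) @[z --> within (closed_ball x0 rho) (nbhs x)] --> 0)
  (xplus_ball : closed_ball x0 (rho / 2) xplus)
  (xplus_solution : F xplus = y)
  (ctc_ge0 : 0 <= ctc) (ctc_lt1 : ctc < 1)
  (tcc : tangential_cone (closed_ball x0 rho) F dF ctc)
  (cF_gt0 : 0 < cF)
  (dF_bounded : forall x, closed_ball x0 rho x -> opnorm (dF x) < cF)
  (F_weakly_closed : weakly_seq_closed D F)
  (tau_large : (1 + ctc) / (1 - ctc) < tau)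
  (yd : R -> Y)
  (yd_noisy : forall delta, 0 < delta -> `|yd delta - y| <= delta)
  (x : R -> nat -> X)
  (x_resesop : forall delta, 0 < delta ->
     resesop F dF ctc tau delta (yd delta) x0 (x delta))
  (t : R -> nat -> nat -> R)
  (t_coefficients : forall delta, 0 < delta ->
     step_coefficients F dF ctc tau delta (yd delta) (x delta) (t delta))
  (unique_solution : forall z, closed_ball x0 rho z -> F z = y -> z = xplus)
  (t_bounded : exists2 tmax : R, 0 < tmax &
     forall n i, i \in indices n ->
       exists2 l : R, `|t delta n i| @[delta --> 0^'+] --> l & l < tmax) :
  x delta (stopping_index F tau delta (yd delta) (x delta))
    @[delta --> 0^'+] --> xplus.
Proof.
set B := closed_ball x0 rho in F_differentiable dF_continuous tcc dF_bounded
  unique_solution *.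
have BE w : B w = (`|x0 - w| <= rho) :> Prop by rewrite /B closed_ballE.
have clB : closed B by exact: closed_ball_closed.
have dFc w : B w -> continuous (dF w) by move=> /F_differentiable[].
have dF_le w : B w -> forall h, `|dF w h| <= cF * `|h|.
  move=> Bw h; apply: le_trans (continuous_opnorm_le (dFc _ Bw) h) _.
  by rewrite ler_wpM2r// ltW// dF_bounded.
(* Here the radius [rho / 2] matters: two such distances add up to at most [rho]. *)
have x0_ball w : `|w - xplus| <= `|x0 - xplus| -> B w.
  move: xplus_ball; rewrite closed_ballE ?divr_gt0// /closed_ball_/= => x0z wz.
  rewrite BE -(subrK xplus x0) -addrA; apply: le_trans (ler_normD _ _) _.
  by rewrite (distrC xplus w); lra.
have Bz : B xplus by apply: x0_ball; rewrite subrr normr0.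
apply: contrapT => /not_cvg_ultrafilter[e e0 [G [GU G0 xe]]].
have G_gt0 : \forall delta \near G, 0 < delta by apply: G0; exact: nbhs_right_gt.
have delta0 : delta @[delta --> G] --> (0 : R).
  by apply: cvg_trans (G0) _; exact: cvg_at_right_filter cvg_id.
have ydy : yd delta @[delta --> G] --> y.
  apply/cvgrPdist_lt => eps eps0; near=> delta; rewrite distrC.
  apply: (@le_lt_trans _ _ delta); first by apply: yd_noisy; near: delta.
  by near: delta; exact: (cvgr_lt _ delta0).
have Bx n : \forall delta \near G, B (x delta n).
  near=> delta; have d0 : 0 < delta by near: delta.
  apply: (x0_ball); exact: (iterate_le_start ctc_ge0 ctc_lt1 cF_gt0 tau_large d0
    tcc dF_le (yd_noisy _ d0) Bz xplus_solution x0_ball (x_resesop _ d0)).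
have far n : \forall delta \near G, e <= `|x delta n - xplus|.
  near=> delta; have d0 : 0 < delta by near: delta.
  apply: le_trans (stopping_index_le ctc_ge0 ctc_lt1 cF_gt0 tau_large d0
    tcc dF_le (yd_noisy _ d0) Bz xplus_solution x0_ball (x_resesop _ d0) n).
  by near: delta.
have B_lim n w : x delta n @[delta --> G] --> w -> B w.
  by move=> xw; apply: (closed_cvg B clB (Bx n) w xw).
have res_lim n w : x delta n @[delta --> G] --> w ->
    residual F (yd delta) (x delta n) @[delta --> G] --> F w - y.
  move=> xw; apply: cvgB => //.
  by apply: (cvg_tangential_cone ctc_lt1 tcc dF_le) => //; exact: B_lim xw.
(* If the discrepancy principle held along [G], the residual bound [tau * delta] would force
   [F w = y], hence [w = xplus] by uniqueness, contrary to [far]. *)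
have nd n (w : X) : x delta n @[delta --> G] --> w ->
    \forall delta \near G, ~ discrepancy F tau delta (yd delta) (x delta n).
  move=> xw; have [disc|//] := in_ultra_setVsetC
    [set delta | discrepancy F tau delta (yd delta) (x delta n)] GU.
  have Fw : F w = y.
    apply/eqP; rewrite -subr_eq0 -normr_le0 -(mulr0 tau).
    apply: (ler_cvg_to (cvg_norm (res_lim _ _ xw)) _ disc).
    by apply: cvgM => //; exact: cvg_cst.
  have : e <= `|w - xplus|.
    apply: (cvgr_to_ge _ (far n)).
    by apply: cvg_norm; apply: cvgB => //; exact: cvg_cst.
  by rewrite (unique_solution _ (B_lim _ _ xw) Fw) subrr normr0 leNgt e0.
have [tmax tmax0 tlim] := t_bounded.
(* The hypothesis controls only absolute values; the ultrafilter supplies the signs. The value 0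
   outside [indices] is a dummy. *)
have /choice[tl0 tlP0] (ni : nat * nat) : exists l, ni.2 \in indices ni.1 ->
    t delta ni.1 ni.2 @[delta --> G] --> l /\ `|l| <= tmax.
  case: ni => n i /=; have [ni|_] := boolP (i \in indices n); last by exists 0.
  have [l tl lt] := tlim _ _ ni.
  have [l' tl' l'l] : exists2 l', t delta n i @[delta --> G] --> l' & `|l'| <= l.
    apply: ultrafilter_cvg_norm; apply: cvg_trans tl.
    exact: cvg_app G0.
  by exists l' => _; split=> //; rewrite (le_trans l'l)// ltW.
pose tl n i := tl0 (n, i).
have tlP n i : i \in indices n ->
    t delta n i @[delta --> G] --> tl n i /\ `|tl n i| <= tmax := @tlP0 (n, i).
have next n (xl : nat -> X) :
    (forall m, (m <= n)%N -> x delta m @[delta --> G] --> xl m) ->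
  x delta n.+1 @[delta --> G] --> xl n -
    \sum_(i <- indices n) tl n i *: search_dir F dF y (xl i).
  move=> xxl.
  apply: (@cvg_trans _ (x delta n - \sum_(i <- indices n) t delta n i *:
      search_dir F dF (yd delta) (x delta i) @[delta --> G])).
    apply: near_eq_cvg; near=> delta; have d0 : 0 < delta by near: delta.
    have [-> //] := t_coefficients _ d0 n.
    by near: delta; exact: nd (xxl n (leqnn n)).
  apply: cvgB; first exact: xxl.
  apply: cvg_bigsum => i ni; apply: cvgZ; first by have [] := tlP _ _ ni.
  have iN : (i <= n)%N.
    move: ni; case: (n) => [|m]; rewrite /= !inE; first by move/eqP ->.
    by case/orP => /eqP ->.
  apply: (cvg_search_dir ctc_lt1 tcc (ltW cF_gt0) dF_le dFc dF_continuous) => //.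
    exact: B_lim (xxl _ iN).
  exact: xxl.
(* Convergence is claimed for all [m <= n] at once since a step involves two earlier iterates. *)
have xcvg n : forall m, (m <= n)%N -> cvg (x delta m @[delta --> G]).
  elim: n => [|n IH] m.
    rewrite leqn0 => /eqP ->; apply/cvg_ex; exists x0.
    apply: (@cvg_trans _ ((fun=> x0) @ G)); last exact: cvg_cst.
    apply: near_eq_cvg; near=> delta; have d0 : 0 < delta by near: delta.
    by have [-> _] := x_resesop _ d0.
  rewrite leq_eqVlt => /predU1P[->|]; last exact: IH.
  apply/cvg_ex; eexists; apply: (next n (fun m => lim (x delta m @[delta --> G]))).
  by move=> k /IH.
pose xl n : X := lim (x delta n @[delta --> G]).
have xxl n : x delta n @[delta --> G] --> xl n by exact: xcvg (leqnn n).
have xl_step n : xl n.+1 = xl n -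
    \sum_(i <- indices n) tl n i *: search_dir F dF y (xl i).
  by apply/cvg_lim => //; exact: next.
have xl_far n : e <= `|xl n - xplus|.
  apply: (cvgr_to_ge _ (far n)).
  by apply: cvg_norm; apply: cvgB => //; exact: cvg_cst.
have cvg_sqr (V : normedModType R) (f : R -> V) (l : V) :
    f delta @[delta --> G] --> l -> `|f delta| ^+ 2 @[delta --> G] --> `|l| ^+ 2.
  by move=> fl; apply: cvgM; apply: cvg_norm.
(* The descent inequality survives the limit because its rate is the same for all [delta]; by [nd]
   it is available along [G] at every index. *)
have xl_descent n : `|xl n.+1 - xplus| ^+ 2 <= `|xl n - xplus| ^+ 2 -
    descent_rate ctc tau cF * `|F (xl n) - y| ^+ 2.
  apply: (@ler_cvg_to _ G _ _ (fun delta => `|x delta n.+1 - xplus| ^+ 2)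
    (fun delta => `|x delta n - xplus| ^+ 2 -
      descent_rate ctc tau cF * `|residual F (yd delta) (x delta n)| ^+ 2)).
  - by apply: cvg_sqr; apply: cvgB => //; exact: cvg_cst.
  - apply: cvgB; first by apply: cvg_sqr; apply: cvgB => //; exact: cvg_cst.
    apply: cvgM; first exact: cvg_cst.
    by apply: cvg_sqr; exact: res_lim.
  near=> delta; have d0 : 0 < delta by near: delta.
  apply: (iterate_descent ctc_ge0 ctc_lt1 cF_gt0 tau_large d0 tcc dF_le
    (yd_noisy _ d0) Bz xplus_solution x0_ball (x_resesop _ d0)).
  by near: delta; exact: nd (xxl n).
have tl_le n i : i \in indices n -> `|tl n i| <= tmax by move=> /tlP[].
have [w [xlw Bw Fw]] := limit_sequence_solution ctc_ge0 ctc_lt1 tcc dF_le Bz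
  xplus_solution (fun n => B_lim _ _ (xxl n)) (ltW tmax0)
  (descent_rate_gt0 ctc_ge0 ctc_lt1 cF_gt0 tau_large) tl_le xl_step xl_descent clB.
have : e <= `|w - xplus|.
  have xl_far_near : \forall n \near \oo, e <= `|xl n - xplus| by exact: nearW.
  apply: (cvgr_to_ge _ xl_far_near).
  by apply: cvg_norm; apply: cvgB => //; exact: cvg_cst.
by rewrite (unique_solution _ Bw Fw) subrr normr0 leNgt e0.
Unshelve. all: by end_near. Qed.
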